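(* Let $V$ be a real locally convex topological vector space, $H$ a real Hilbert space, $j:V\to H$ a linear, weak-to-weak continuous operator, and let $\varphi: V\to\mathbb{R}\cup\{+\infty\}$ be convex. Then the $j$-subgradient $\partial_j\varphi\subseteq H\times H$ is cyclically monotone.
   Context: The effective domain of $\varphi$ is $D(\varphi)=\{\varphi<+\infty\}$. The $j$-subgradient of $\varphi$ is the (possibly multivalued) operator, viewed as a relation on $H$, $$\partial_j\varphi=\Big\{(u,f)\in H\times H \;:\; \exists\,\hat u\in D(\varphi)\text{ with } j(\hat u)=u \text{ and, for every }\hat v\in V,\ \liminf_{t\searrow 0}\frac{\varphi(\hat u+t\hat v)-\varphi(\hat u)}{t}\ge\langle f,j(\hat v)\rangle_H\Big\}.$$ A finite sequence $((u_i,f_i))_{0\le i\le n}$ is called cyclic if $(u_0,f_0)=(u_n,f_n)$. An operator $A\subseteq H\times H$ is cyclically monotone if for every cyclic sequence $((u_i,f_i))_{0\le i\le n}$ in $A$ one has $\sum_{i=1}^n\langle f_i,u_i-u_{i-1}\rangle_H\ge 0$. *)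

(* Defs.v *)
From HB Require Import structures.
From mathcomp Require Import all_boot all_order all_algebra.
From mathcomp Require Import all_classical all_reals all_analysis.

Set Implicit Arguments.
Unset Strict Implicit.
Unset Printing Implicit Defensive.

Import Order.TTheory GRing.Theory Num.Theory.
Import numFieldNormedType.Exports.

Local Open Scope classical_set_scope.
Local Open Scope ring_scope.

(* A real Hilbert space: a complete normed space whose norm comes from a
   symmetric positive definite bilinear form. *)
HB.mixin Record CompleteNormedModule_isHilbert (R : realType) H
    & CompleteNormedModule R H := {
  inner : {dot H for (@idfun R)} ;
  inner_norm : forall x : H, inner x x = `|x| ^+ 2
}.

#[short(type="hilbertType")]
HB.structure Definition Hilbert (R : realType) :=
  {H of CompleteNormedModule_isHilbert R H & CompleteNormedModule R H}.

Section weak_topology.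
Context (R : realType) (E : topologicalLmodType R).

Definition continuous_dual : Type :=
  {f : {scalar E} | continuous (f : E -> R)}.

(* The coarsest topology making all continuous linear functionals continuous. *)
Definition weak_topology : topologicalType :=
  @sup_topology E continuous_dual (fun f =>
    Topological.class (initial_topology (sval f : E -> R))).

End weak_topology.

Definition weak_to_weak_continuous (R : realType) (E F : topologicalLmodType R)
    (j : E -> F) : Prop :=
  continuous (j : weak_topology E -> weak_topology F).

Section extended_real_functionals.
Context (R : realType) (V : lmodType R).
Local Open Scope ereal_scope.

Definition convex_efun (phi : V -> \bar R) : Prop :=
  forall (x y : V) (t : R), (0 < t < 1)%R ->
    phi (t *: x + (1 - t) *: y)%R <= t%:E * phi x + (1 - t)%:E * phi y.

Definition effective_domain (phi : V -> \bar R) : set V :=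
  [set u | phi u < +oo].

End extended_real_functionals.

(* Subtracting [phi u] is harmless: it is finite for [u] in the effective
   domain of a functional that never takes the value [-oo]. *)
Definition j_subgradient (R : realType) (V : lmodType R) (H : hilbertType R)
    (j : V -> H) (phi : V -> \bar R) : set (H * H) :=
  [set uf | exists2 u : V, effective_domain phi u &
     j u = uf.1 /\
     forall v : V,
       ((inner uf.2 (j v))%:E <=
        limf_einf (fun t : R => (phi (u + t *: v)%R - phi u) / t%:E)
                  (0 : R)^'+)%E].

Definition cyclic_sequence (T : Type) (n : nat) (x : nat -> T) : Prop :=
  x 0%N = x n.

(* A finite sequence indexed by 0, ..., n is given by the values at indices
   at most n of a function on [nat]. *)
Definition cyclically_monotone (R : realType) (H : hilbertType R)
    (A : set (H * H)) : Prop :=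
  forall (n : nat) (x : nat -> H * H),
    (forall i, (i <= n)%N -> A (x i)) -> cyclic_sequence n x ->
    0 <= \sum_(1 <= i < n.+1) inner (x i).2 ((x i).1 - (x i.-1).1).

(* Main.v *)
Require Import Defs.
From HB Require Import structures.
From mathcomp Require Import all_boot all_order all_algebra.
From mathcomp Require Import all_classical all_reals all_analysis.
From mathcomp Require Import lra.

Set Implicit Arguments.
Unset Strict Implicit.
Unset Printing Implicit Defensive.

Import Order.TTheory GRing.Theory Num.Theory.
Import numFieldNormedType.Exports.

Local Open Scope classical_set_scope.
Local Open Scope ring_scope.

(** As for ordinary subgradients, convexity turns the local condition that
    defines [(u, f)] in the [j]-subgradient into a global inequality: if [uh] is
    the lift of [u] in that condition and [w] is in the effective domain, the
    difference quotients of [phi] at [uh] towards [w] are at most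
    [phi w - phi uh] for small positive steps, so that
    [<f, j w - u> <= phi w - phi uh] ([j_subgradient_lift]).

    Along a cyclic sequence [(u_i, f_i)] with lifts [uh_i], taking
    [w = uh_(i-1)] gives [<f_i, u_i - u_(i-1)> >= phi uh_i - phi uh_(i-1)], and
    the right-hand sides telescope to [phi uh_n - phi uh_0].  Since [j] need not
    be injective, [u_0 = u_n] alone would not make this vanish; the lifts are
    therefore chosen as a function of the pair [(u_i, f_i)], so that
    [uh_0 = uh_n]. *)

(** Every set of a proper filter meets the one on which [f <= c], so no infimum
    of [f] over a set of the filter exceeds [c]. *)
Lemma limf_einf_le (T : choiceType) (X : filteredType T) (R : realType)
    (f : X -> \bar R) (F : set_system X) (FF : ProperFilter F) (c : \bar R) :
  (\forall t \near F, f t <= c)%E -> (limf_einf f F <= c)%E.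
Proof.
move=> fc; rewrite limf_einfE; apply: ge_ereal_sup => _ [A FA <-].
have [t [At ftc]] := filter_ex (filterI FA fc).
by apply: ge_ereal_inf; exists (f t) => //; exists t.
Qed.

(** The point [u + t *: (w - u)] is the convex combination
    [t *: w + (1 - t) *: u], so that [phi] lies below its chord there. *)
Lemma convex_difference_quotient_le (R : realType) (V : lmodType R)
    (phi : V -> \bar R) (phi_ninfty : forall v, phi v != -oo%E)
    (phi_convex : convex_efun phi) (u w : V) (t : R) :
  phi u \is a fin_num -> phi w \is a fin_num -> 0 < t < 1 ->
  ((phi (u + t *: (w - u))%R - phi u) / t%:E <= phi w - phi u)%E.
Proof.
move=> /fineK; set a := fine _ => ua /fineK; set b := fine _ => wb t01.
have -> : u + t *: (w - u) = t *: w + (1 - t) *: u.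
  by rewrite scalerBr scalerBl scale1r addrC addrAC -addrA.
have := phi_convex w u t t01; have := phi_ninfty (t *: w + (1 - t) *: u).
rewrite -ua -wb; case: (phi _) => [c _|//|//] /=.
rewrite -!EFinM -!EFinD lee_fin => cab.
have /andP[t0 _] := t01.
rewrite inver gt_eqF// -EFinM lee_fin ler_pdivrMr//.
lra.
Qed.

(** The bound on the difference quotients holds for steps in [(0, 1)], hence
    near [0] from the right, and passes to their lower limit. *)
Lemma j_subgradient_lift (R : realType) (V : lmodType R) (H : hilbertType R)
    (j : {linear V -> H}) (phi : V -> \bar R)
    (phi_ninfty : forall v, phi v != -oo%E) (phi_convex : convex_efun phi)
    (uf : H * H) :
  j_subgradient j phi uf ->
  exists uh : V, [/\ phi uh \is a fin_num, j uh = uf.1 &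
    forall w, phi w \is a fin_num ->
      inner uf.2 (j w - uf.1) <= fine (phi w) - fine (phi uh)].
Proof.
case=> uh uh_dom [juh sub_uh].
have uh_fin : phi uh \is a fin_num by rewrite fin_numE phi_ninfty/= lt_eqF.
exists uh; split=> // w w_fin.
rewrite -juh -linearB -lee_fin EFinB !fineK//.
apply: (le_trans (sub_uh _)); apply: limf_einf_le.
near=> t; apply: convex_difference_quotient_le => //.
by apply/andP; split; near: t; [exact: nbhs_right_gt | exact: nbhs_right_lt].
Unshelve. all: by end_near. Qed.

Theorem lemma2p4 (R : realType) (V : tvsType R) (H : hilbertType R)
    (j : {linear V -> H}) (phi : V -> \bar R)
    (j_weak : weak_to_weak_continuous j)
    (phi_ninfty : forall v : V, phi v != -oo%E)
    (phi_convex : convex_efun phi) :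
  cyclically_monotone (j_subgradient j phi).
Proof.
move=> n x subx cyc.
(* The lift depends on the pair only, not on its position in the sequence. *)
have /choice[lift liftP] : forall uf, exists uh, j_subgradient j phi uf ->
    [/\ phi uh \is a fin_num, j uh = uf.1 &
      forall w, phi w \is a fin_num ->
        inner uf.2 (j w - uf.1) <= fine (phi w) - fine (phi uh)].
  move=> uf.
  have [uf_sub|nsub] := pselect (j_subgradient j phi uf); last by exists 0.
  have [uh uhP] := j_subgradient_lift phi_ninfty phi_convex uf_sub.
  by exists uh.
pose p i := fine (phi (lift (x i))).
have sum0 : \sum_(1 <= i < n.+1) (p i - p i.-1) = 0.
  by rewrite big_add1/= telescope_sumr// /p cyc subrr.
rewrite -[leLHS]sum0 !big_nat; apply: ler_sum => i /andP[i1]; rewrite ltnS => i_n.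
have [_ _ gap_i] := liftP _ (subx _ i_n).
have [fin_pred j_pred _] := liftP _ (subx _ (leq_trans (leq_pred i) i_n)).
have := gap_i _ fin_pred; rewrite j_pred -[X in inner _ X]opprB linearNr -/(p i) -/(p i.-1).
lra.
Qed.
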